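(* Let $p$ be a prime, $n\ge1$, $X$ a nonempty totally ordered set, $S$ the free profinite group on the basis $X$, and $H$ a Hall set in $X^*$. Then the cosets of the elements $\sigma_w$, where $w\in H$ has length $i\in J(n)$, generate $S_{(n,p)}/(S_{(n,p)})^p[S,S_{(n,p)}]$.
   Context: For a profinite group $G$: $[K,K']$, $K^m$ are the closed subgroups generated by commutators $[k,k']=k^{-1}k'^{-1}kk'$, resp. $m$-th powers; $G^{(1)}=G$, $G^{(i+1)}=[G,G^{(i)}]$; $G_{(n,p)}$ is the closed subgroup generated by all $(G^{(i)})^{p^j}$ with $ip^j\ge n$. $j_n(i)=\lceil\log_p(n/i)\rceil$ (least $j\ge0$ with $ip^j\ge n$) for $1\le i\le n$; $J(n)$ is the set of integers $1\le i\le n$ of the form $\lceil n/p^k\rceil$, $k\ge0$. Hall sets: $\mathcal{M}_X$ is the free magma on $X$ (nonempty nonassociative words, product $(u,v)\mapsto(uv)$), $f:\mathcal{M}_X\to X^*$ the bracket-dropping map. $(\mathcal{H},\le)$, $\mathcal{H}\subseteq\mathcal{M}_X$ totally ordered, is a Hall set if: (1) $X\subseteq\mathcal{H}$ as ordered sets; (2) if $h=(h'h'')\in\mathcal{H}\setminus X$ then $h''\in\mathcal{H}$ and $h<h''$; (3) for $h=(h'h'')\in\mathcal{M}_X\setminus X$, $h\in\mathcal{H}$ iff $h',h''\in\mathcal{H}$, $h'<h''$, and either $h'\in X$ or $h'=(h_1h_2)$ with $h_2\ge h''$. $H=f(\mathcal{H})$ is a Hall set in $X^*$; each $w\in H$ equals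 $f(h)$ for a unique $h\in\mathcal{H}$, and for $w\notin X$, $h=(h'h'')$ and $w=f(h')f(h'')$ is the standard factorization. Define $\tau_{(x)}=x$ and $\tau_w=[\tau_u,\tau_v]$ for the standard factorization $w=uv$; $\sigma_w=\tau_w^{p^{j_n(|w|)}}$ for $|w|\le n$. *)

(* Defs.v *)
From HB Require Import structures.
From mathcomp Require Import all_boot all_order.
From mathcomp Require Import boolp classical_sets functions cardinality topology.

Set Implicit Arguments.
Unset Strict Implicit.
Unset Printing Implicit Defensive.

Local Open Scope classical_set_scope.
Local Open Scope group_scope.

HB.structure Definition PreTopologicalGroup := {G of Topological G & Group G}.

HB.mixin Record PreTopologicalGroup_isTopologicalGroup G
    of PreTopologicalGroup G := {
  mulg_continuous : continuous (fun x : G * G => x.1 * x.2) ;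
  invg_continuous : continuous (fun x : G => x^-1)
}.

#[short(type="topologicalGroupType")]
HB.structure Definition TopologicalGroup :=
  {G of PreTopologicalGroup G & PreTopologicalGroup_isTopologicalGroup G}.

HB.mixin Record TopologicalGroup_isProfinite G of TopologicalGroup G := {
  profinite_compact : compact [set: G] ;
  profinite_hausdorff : hausdorff_space G ;
  profinite_totally_disconnected : totally_disconnected [set: G]
}.

#[short(type="profiniteGroupType")]
HB.structure Definition ProfiniteGroup :=
  {G of TopologicalGroup G & TopologicalGroup_isProfinite G}.

Section Subgroups.
Variable G : topologicalGroupType.
Implicit Types (A B K N : set G).

Definition is_subgroup K : Prop :=
  [/\ K 1, (forall x y, K x -> K y -> K (x * y)) & (forall x, K x -> K x^-1)].

Definition is_normal_subgroup K : Prop :=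
  is_subgroup K /\ (forall x y, K x -> K (x ^ y)).

Definition is_closed_subgroup K : Prop := is_subgroup K /\ closed K.

Definition closed_gen A : set G := smallest is_closed_subgroup A.

Definition closed_commg A B : set G :=
  closed_gen [set [~ x, y] | x in A & y in B].

Definition closed_power A (m : nat) : set G := closed_gen [set x ^+ m | x in A].

Definition set_mulg A B : set G := [set x * y | x in A & y in B].

Definition set_invg A : set G := [set x^-1 | x in A].

Definition left_coset N x : set G := [set x * y | y in N].

(* For N normal in K, the quotient group K / N is realized as the set of its
   cosets, with the product and inverse of cosets taken as subsets of G. *)
Definition quotient_set K N : set (set G) := [set left_coset N x | x in K].

(* The last clause is closedness in the quotient topology of K / N: the
   preimage of U in K is closed for the subspace topology of K. *)
Definition is_closed_subgroup_quotient K N (U : set (set G)) : Prop :=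
  [/\ U `<=` quotient_set K N,
      U N,
      (forall A B, U A -> U B -> U (set_mulg A B)),
      (forall A, U A -> U (set_invg A)) &
      exists2 C, closed C & [set x | K x /\ U (left_coset N x)] = K `&` C].

(* Topological generation of K / N by a set T of cosets. *)
Definition generates_quotient K N (T : set (set G)) : Prop :=
  T `<=` quotient_set K N /\
  smallest (is_closed_subgroup_quotient K N) T = quotient_set K N.

(* lower_central i is G^(i) for 1 <= i; the value at 0 is a dummy. *)
Fixpoint lower_central (i : nat) : set G :=
  if i is (_.+1 as j).+1 then closed_commg [set: G] (lower_central j)
  else [set: G].

Definition zassenhaus (n p : nat) : set G :=
  closed_gen (\bigcup_(ij in [set ij : nat * nat |
                               (1 <= ij.1)%N /\ (n <= ij.1 * p ^ ij.2)%N])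
                closed_power (lower_central ij.1) (p ^ ij.2)%N).

End Subgroups.

Definition converges_to_1 (X : Type) (G : topologicalGroupType)
    (phi : X -> G) : Prop :=
  forall N : set G, is_normal_subgroup N -> open N ->
    finite_set [set x | ~ N (phi x)].

(* For infinite X, a basis of a free profinite group is understood to converge
   to 1 (Fried-Jarden, Field Arithmetic, section 17.4); for finite X this
   condition is void. *)
Definition is_free_profinite (X : Type) (S : profiniteGroupType)
    (iota : X -> S) : Prop :=
  [/\ converges_to_1 iota,
      closed_gen (range iota) = [set: S] &
      forall (G : profiniteGroupType) (phi : X -> G),
        converges_to_1 phi -> closed_gen (range phi) = [set: G] ->
        exists! psi : S -> G,
          [/\ continuous psi, {morph psi : x y / x * y} & psi \o iota = phi]].

Inductive free_magma (X : Type) : Type :=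
  | Letter of X
  | Bracket of free_magma X & free_magma X.

Fixpoint foliage (X : Type) (h : free_magma X) : seq X :=
  match h with
  | Letter x => [:: x]
  | Bracket h' h'' => foliage h' ++ foliage h''
  end.

(* The relation le is only relevant on the set HH. *)
Record is_hall_set (d : Order.disp_t) (X : orderType d)
    (HH : set (free_magma X)) (le : free_magma X -> free_magma X -> Prop)
    : Prop := IsHallSet {
  hall_le_refl : forall h, HH h -> le h h ;
  hall_le_anti : forall h k, HH h -> HH k -> le h k -> le k h -> h = k ;
  hall_le_trans : forall h k l, HH h -> HH k -> HH l ->
    le h k -> le k l -> le h l ;
  hall_le_total : forall h k, HH h -> HH k -> le h k \/ le k h ;
  hall_letter : forall x, HH (Letter x) ;
  hall_letter_le : forall x y, le (Letter x) (Letter y) <-> (x <= y)%O ;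
  hall_right : forall h' h'', HH (Bracket h' h'') ->
    HH h'' /\ (le (Bracket h' h'') h'' /\ Bracket h' h'' <> h'') ;
  hall_bracket : forall h' h'', HH (Bracket h' h'') <->
    [/\ HH h', HH h'', le h' h'' /\ h' <> h'' &
        (exists x, h' = Letter x) \/
        (exists h1 h2, h' = Bracket h1 h2 /\ le h'' h2)]
}.

Definition hall_words (X : Type) (HH : set (free_magma X)) : set (seq X) :=
  [set foliage h | h in HH].

Section Tau.
Variables (X : Type) (S : groupType) (iota : X -> S).

Fixpoint tau_tree (h : free_magma X) : S :=
  match h with
  | Letter x => iota x
  | Bracket h' h'' => [~ tau_tree h', tau_tree h'']
  end.

(* For w in hall_words HH, the tree h in HH with foliage h = w is unique
   (hall_foliage_inj), so that tau obeys the recursion along standard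
   factorizations (tau_letter, tau_bracket). *)
Definition tau (HH : set (free_magma X)) (w : seq X) : S :=
  xget 1 [set tau_tree h | h in [set h | HH h /\ foliage h = w]].

End Tau.

Definition ceil_div (m k : nat) : nat := ((m + k.-1) %/ k)%N.

(* ceil (log_p (n / i)); see j_index_leq. *)
Definition j_index (p n i : nat) : nat := up_log p (ceil_div n i).

Definition J_set (p n : nat) : set nat :=
  [set i | (1 <= i <= n)%N /\ exists k, i = ceil_div n (p ^ k)].

Definition sigma (p n : nat) (X : Type) (S : groupType) (iota : X -> S)
    (HH : set (free_magma X)) (w : seq X) : S :=
  tau iota HH w ^+ (p ^ j_index p n (size w))%N.

Lemma ceil_div_leq (m k q : nat) :
  (0 < k)%N -> (ceil_div m k <= q)%N = (m <= k * q)%N.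
Proof.
move=> k0; rewrite /ceil_div -ltnS ltn_divLR // mulSn mulnC.
by rewrite -[in ltnLHS](prednK k0) /= -{2}(prednK k0) addSn ltnS addnC leq_add2l.
Qed.

Lemma j_index_leq (p n i j : nat) : prime p -> (0 < i)%N ->
  (j_index p n i <= j)%N = (n <= i * p ^ j)%N.
Proof.
move=> /prime_gt1 p1 i0; rewrite -ceil_div_leq //.
apply/idP/idP => [le_j|]; last exact: up_log_min.
apply: leq_trans (up_logP _ p1) _; rewrite leq_exp2l //.
Qed.

Section HallUniqueness.
Variables (d : Order.disp_t) (X : orderType d) (HH : set (free_magma X)).
Variables (le : free_magma X -> free_magma X -> Prop).
Hypothesis hallH : is_hall_set HH le.

Let lt h k := `[< le h k /\ h <> k >].

Let reduce := fix reduce h (s : seq (free_magma X)) {struct s} :=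
  if s is k :: s' then
    if lt h k then reduce (Bracket h k) s' else h :: s
  else [:: h].

Let push w s := foldr (fun x => reduce (Letter x)) s w.

Let small h (s : seq (free_magma X)) : Prop :=
  if h is Bracket _ h'' then if s is k :: _ then HH k /\ le k h'' else True
  else True.

Let push_foliage h s : HH h -> small h s -> push (foliage h) s = reduce h s.
Proof.
elim: h s => [//|h' IH' h'' IH''] s Hh sm.
have [Hh' Hh'' lth' h'P] := (hall_bracket hallH _ _).1 Hh.
have tail_small : small h'' s.
  case: h'' {IH'' lth' h'P} Hh Hh'' sm => [//|a b] Hh Hh'' /=.
  case: s => [//|k s] [Hk lek]; split=> //.
  have [Hb [leb _]] := hall_right hallH Hh''.
  exact: (hall_le_trans hallH Hk Hh'' Hb lek leb).
have -> : push (foliage (Bracket h' h'')) s =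
    push (foliage h') (push (foliage h'') s) by exact: foldr_cat.
rewrite IH'' //.
have -> : reduce h'' s = h'' :: s.
  case: s sm {tail_small} => [//|k s] /= [Hk lek].
  rewrite /lt; case: asboolP => // -[lek' nek]; case: nek.
  exact: (hall_le_anti hallH Hh'' Hk lek' lek).
rewrite IH' //; last first.
  by clear sm; case: h' h'P {IH' Hh Hh' lth'} => //= a b [[x //]|[? [h2 [[_ ->]]]]].
by rewrite /=; rewrite /lt asboolT.
Qed.

Lemma hall_foliage_inj h k : HH h -> HH k -> foliage h = foliage k -> h = k.
Proof.
move=> Hh Hk ehk.
have e t : HH t -> push (foliage t) [::] = [:: t].
  by move=> Ht; rewrite push_foliage //; case: (t).
by have := e _ Hh; rewrite ehk e // => -[].
Qed.

Variables (S : groupType) (iota : X -> S).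

Lemma tau_foliage h : HH h -> tau iota HH (foliage h) = tau_tree iota h.
Proof.
move=> Hh; apply: xget_unique; first by exists h.
by move=> _ [k [Hk /(hall_foliage_inj Hk Hh) ->] <-].
Qed.

Lemma tau_letter x : tau iota HH [:: x] = iota x.
Proof. exact: (tau_foliage (hall_letter hallH x)). Qed.

Lemma tau_bracket h' h'' : HH (Bracket h' h'') ->
  tau iota HH (foliage h' ++ foliage h'') =
  [~ tau iota HH (foliage h'), tau iota HH (foliage h'')].
Proof.
move=> Hh; have [Hh' Hh'' _ _] := (hall_bracket hallH _ _).1 Hh.
by have /= -> := tau_foliage Hh; rewrite !tau_foliage.
Qed.

End HallUniqueness.

(* Main.v *)
(* The group S_(n,p)/N is central in S/N and of exponent p. By descending
   induction on i, every p^j-th power of an element of G^(i) with i p^j >= n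
   lies in any closed subgroup U containing N and the sigma_w. Indeed, the
   Hall-Petrescu formula
     x^q y^q = (x y)^q c_2^C(q,2) ... c_q^C(q,q),  q = p^j, c_k in G^(ik),
   makes x |-> x^q multiplicative on G^(i) modulo U, because C(p^j, k) is
   divisible by some p^s with p^j <= k p^s. So it suffices to consider
   generators of G^(i) modulo G^(i+1): the Hall commutators tau_w if i is in
   J(n), and the commutators [b, a] with b in G^(i-1) otherwise. The
   Hall-Petrescu formula comes from Leibman's polynomial sequences. *)

Require Import Defs.
From HB Require Import structures.
From mathcomp Require Import all_boot all_order.
From mathcomp Require Import boolp classical_sets functions cardinality topology.

Local Open Scope classical_set_scope.

Set Implicit Arguments.
Unset Strict Implicit.
Unset Printing Implicit Defensive.
Local Open Scope group_scope.

(* A rewriting system deciding equality in free groups. *)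
Definition free_group_simp (G : groupType) :=
  (=^~ @mulgA G, @invgM G, @invgK G, @invg1 G, @mulKg G, @mulVKg G,
   @mulgV G, @mulVg G, @mulg1 G, @mul1g G).

Ltac free_group := by rewrite /commg /conjg !free_group_simp.

(** * Subgroups, continuity and topological generation *)

Section Subgroup.
Variables (G : topologicalGroupType) (K : set G).
Hypothesis sK : is_subgroup K.

Lemma subgroup1 : K 1. Proof. by case: sK. Qed.

Lemma subgroupM x y : K x -> K y -> K (x * y).
Proof. by case: sK => _ + _; apply. Qed.

Lemma subgroupV x : K x -> K x^-1. Proof. by case: sK => _ _; apply. Qed.

Lemma subgroupX x m : K x -> K (x ^+ m).
Proof.
move=> Kx; elim: m => [|m IH]; first exact: subgroup1.
by rewrite expgS; apply: subgroupM.
Qed.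

Lemma subgroup_invR x y : K [~ x, y] -> K [~ y, x].
Proof. by move=> /subgroupV; rewrite invgR. Qed.

Lemma subgroupMl x y : K x -> K (x * y) -> K y.
Proof. by move=> /subgroupV Kx /(subgroupM Kx); rewrite mulKg. Qed.

Lemma subgroupMr x y : K y -> K (x * y) -> K x.
Proof. by move=> /subgroupV Ky /subgroupM /(_ Ky); rewrite mulgK. Qed.

End Subgroup.

Section Continuity.
Variables (G : topologicalGroupType).
Implicit Types (f g : G -> G) (K : set G).

Lemma continuous_mulg f g :
  continuous f -> continuous g -> continuous (fun x => f x * g x).
Proof.
move=> fc gc x; apply: (@continuous2_cvg _ _ _ _ _ _ f g (fun a b => a * b)).
- exact: (@mulg_continuous G (f x, g x)).
- exact: fc.
- exact: gc.
Qed.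

Lemma continuous_invg f : continuous f -> continuous (fun x => (f x)^-1).
Proof.
by move=> fc x; apply: (continuous_comp (fc x)); exact: invg_continuous.
Qed.

Lemma continuous_expg m : continuous (fun x : G => x ^+ m).
Proof.
elim: m => [|m IH]; first exact: cst_continuous.
rewrite (_ : (fun x => _) = fun x : G => x * x ^+ m).
  by apply: continuous_mulg => // x; exact: cvg_id.
by apply: funext => x; rewrite expgS.
Qed.

Lemma continuous_conjg y : continuous (fun x : G => x ^ y).
Proof.
apply: continuous_mulg; first exact: cst_continuous.
by apply: continuous_mulg; [move=> x; exact: cvg_id | exact: cst_continuous].
Qed.

Lemma continuous_commgl y : continuous (fun x : G => [~ x, y]).
Proof.
apply: continuous_mulg; last exact: continuous_conjg.
by apply: continuous_invg => x; exact: cvg_id.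
Qed.

Lemma closed_preimage f K : continuous f -> closed K -> closed (f @^-1` K).
Proof. by move=> /continuous_closedP; apply. Qed.

End Continuity.

Section ClosedGen.
Variables (G : topologicalGroupType).
Implicit Types (A K : set G).

Lemma closed_gen_closed_subgroup A : is_closed_subgroup (closed_gen A).
Proof.
split; last first.
  rewrite /closed_gen /smallest => x clx K /= [[sK cK] AK].
  by apply: (cK) => B /clx [y [yA yB]]; exists y; split=> //; apply: yA.
split.
- by move=> K [[[]]].
- by move=> x y Ax Ay K [[sK cK] AK]; apply: (subgroupM sK); [apply: Ax|apply: Ay].
- by move=> x Ax K [[sK cK] AK]; apply: (subgroupV sK); apply: Ax.
Qed.

Lemma closed_gen_subgroup A : is_subgroup (closed_gen A).
Proof. by have [] := closed_gen_closed_subgroup A. Qed.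

Lemma closed_gen_closed A : closed (closed_gen A).
Proof. by have [] := closed_gen_closed_subgroup A. Qed.

Lemma mem_closed_gen A x : A x -> closed_gen A x.
Proof. exact: sub_gen_smallest. Qed.

Lemma closed_gen_min A K :
  is_subgroup K -> closed K -> A `<=` K -> closed_gen A `<=` K.
Proof. by move=> sK cK; apply: smallest_sub. Qed.

Lemma closed_gen_normal A :
  (forall x y, A x -> A (x ^ y)) -> is_normal_subgroup (closed_gen A).
Proof.
move=> nA; have sgA := closed_gen_subgroup A; split=> // x y.
move: x; apply: (@closed_gen_min A [set x | closed_gen A (x ^ y)]).
- split=> /=; first by rewrite conj1g; exact: (subgroup1 sgA).
    by move=> x z ? ?; rewrite conjMg; exact: (subgroupM sgA).
  by move=> x ?; rewrite conjVg; exact: (subgroupV sgA).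
- exact: (closed_preimage (@continuous_conjg _ y) (@closed_gen_closed A)).
- by move=> x Ax; apply: mem_closed_gen; apply: nA.
Qed.

Lemma closed_power_normal K m :
  is_normal_subgroup K -> is_normal_subgroup (closed_power K m).
Proof.
move=> [_ nK]; apply: closed_gen_normal => _ y [x Kx <-].
by rewrite conjXg; exists (x ^ y) => //; apply: nK.
Qed.

Lemma closed_commg_normal K :
  is_normal_subgroup K -> is_normal_subgroup (closed_commg [set: G] K).
Proof.
move=> [_ nK]; apply: closed_gen_normal => _ y [x _ [z Kz <-]].
by rewrite conjRg; exists (x ^ y) => //; exists (z ^ y) => //; apply: nK.
Qed.

Lemma mem_closed_commg A K x y : A x -> K y -> closed_commg A K [~ x, y].
Proof. by move=> Ax Ky; apply: mem_closed_gen; exists x => //; exists y. Qed.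

Lemma mem_closed_power K x m : K x -> closed_power K m (x ^+ m).
Proof. by move=> Kx; apply: mem_closed_gen; exists x. Qed.

Lemma set_mulg_subgroup A K :
  is_normal_subgroup A -> is_subgroup K -> is_subgroup (set_mulg A K).
Proof.
move=> [sA nA] sK; split.
- exists 1; first exact: (subgroup1 sA).
  by exists 1; [exact: (subgroup1 sK) | rewrite mulg1].
- move=> _ _ [a Aa [k Kk <-]] [b Ab [l Kl <-]].
  exists (a * b ^ k^-1); first by apply: (subgroupM sA) => //; apply: nA.
  by exists (k * l); [exact: (subgroupM sK) | free_group].
- move=> _ [a Aa [k Kk <-]].
  exists (a^-1 ^ k); first by apply: nA; exact: (subgroupV sA).
  by exists k^-1; [exact: (subgroupV sK) | free_group].
Qed.

Lemma set_mulg_normal A K :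
  is_normal_subgroup A -> is_normal_subgroup K ->
  is_normal_subgroup (set_mulg A K).
Proof.
move=> nA [sK nK]; split; first exact: set_mulg_subgroup.
move=> _ y [a Aa [k Kk <-]]; exists (a ^ y); first exact: nA.2.
by exists (k ^ y); [exact: nK | rewrite conjMg].
Qed.

End ClosedGen.

(** * The lower central series *)

Section LowerCentral.
Variables (G : topologicalGroupType).
Notation lc := (@lower_central G).

Lemma lower_central_normal i : is_normal_subgroup (lc i).
Proof.
elim: i => [|[|i] IH] //; exact: closed_commg_normal.
Qed.

Lemma lower_central_subgroup i : is_subgroup (lc i).
Proof. by have [] := lower_central_normal i. Qed.

Lemma lower_central_closed i : closed (lc i).
Proof. by case: i => [|[|i]]; [exact: closedT..|exact: closed_gen_closed]. Qed.

Lemma lower_central_conj i x y : lc i x -> lc i (x ^ y).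
Proof. exact: (lower_central_normal i).2. Qed.

Lemma mem_lower_centralS i x y : lc i y -> lc i.+1 [~ x, y].
Proof. by case: i => [//|i] lcy; apply: mem_closed_commg. Qed.

Lemma lower_centralS i : lc i.+1 `<=` lc i.
Proof.
case: i => [//|i]; apply: closed_gen_min.
- exact: lower_central_subgroup.
- exact: lower_central_closed.
move=> _ [x _ [y lcy <-]]; rewrite commgEr.
apply: (subgroupM (lower_central_subgroup _)) => //; apply: lower_central_conj.
exact: (subgroupV (lower_central_subgroup _)).
Qed.

Lemma lower_centralW i j : (i <= j)%N -> lc j `<=` lc i.
Proof.
move=> /subnK <-; elim: (j - i)%N => [//|k IH].
by rewrite addSn => x /lower_centralS /IH.
Qed.

(* By the Hall-Witt identity, as in the three subgroups lemma. *)
Lemma lower_central_commg i j x y : lc i x -> lc j y -> lc (i + j) [~ x, y].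
Proof.
elim: i j x y => [|[|i] IH] j x y.
(* Index 0 stands for G itself, so this case is the normality of G^(j); sequences of degree 0 below
   rely on it. *)
- move=> _ lcy; rewrite add0n commgEr.
  apply: (subgroupM (lower_central_subgroup _)) => //; apply: lower_central_conj.
  exact: (subgroupV (lower_central_subgroup _)).
- by move=> _; apply: mem_lower_centralS.
move=> + lcy; have sL := lower_central_subgroup (i.+2 + j).
have nL := lower_central_conj (i := (i.+2 + j)%N).
move: x; apply: (@closed_gen_min _ _ [set x | lc (i.+2 + j) [~ x, y]]).
- split=> [|x z|x] /=; first by rewrite comm1g; exact: subgroup1.
    move=> xy zy; rewrite (_ : [~ _, _] = [~ x, y] ^ z * [~ z, y]); last free_group.
    by apply: (subgroupM sL) => //; apply: (nL).
  move=> xy; rewrite (_ : [~ _, _] = [~ x, y]^-1 ^ x^-1); last free_group.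
  by apply: nL; apply: (subgroupV sL).
- exact: (closed_preimage (@continuous_commgl _ y)
                           (@lower_central_closed (i.+2 + j))).
move=> _ [g _ [h lch <-]] /=.
have sJ := lower_central_subgroup.
(* The two other Hall-Witt terms: both fall under the induction hypothesis for [h], of weight
   [i.+1], as bracketing with [g] raises the weight by one. *)
have hyg : lc (i.+2 + j) [~ [~ h^-1, y^-1], g].
  apply: (subgroup_invR (sJ _)).
  by apply/mem_lower_centralS/IH; apply: (subgroupV (sJ _)).
have ygh : lc (i.+2 + j) [~ [~ y, g^-1], h^-1].
  apply: (subgroup_invR (sJ _)); rewrite addSnnS.
  apply: IH; first exact: (subgroupV (sJ _)).
  by apply: (subgroup_invR (sJ _)); exact: mem_lower_centralS.
rewrite (_ : [~ _, _] = ([~ [~ h^-1, y^-1], g] ^ y *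
                         [~ [~ y, g^-1], h^-1] ^ g)^-1 ^ h); last free_group.
apply: (nL); apply: (subgroupV sL).
by apply: (subgroupM sL); apply: (nL).
Qed.
End LowerCentral.

Arguments lower_central_normal {G} i.
Arguments lower_central_subgroup {G} i.
Arguments lower_central_closed {G} i.

(** * Polynomial sequences *)

Section PolynomialSequences.
Variables (G : topologicalGroupType) (e : nat).
Implicit Types (g h : nat -> G).
Notation lc := (@lower_central G).

Definition shift_quotient g : nat -> G := fun m => (g m)^-1 * g m.+1.

(* Leibman's polynomial sequences, truncated at the k-th iterated shift quotient
   so that their closure properties follow by induction on k, without any
   nilpotency assumption. *)
Fixpoint polynomial_seq (k d : nat) g : Prop :=
  (forall m, lc d (g m)) /\
  if k is k'.+1 then polynomial_seq k' (d + e) (shift_quotient g) else True.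

Lemma polynomial_seq_val k d g m : polynomial_seq k d g -> lc d (g m).
Proof. by case: k => [|k] [+ _]; apply. Qed.

Lemma eq_polynomial_seq k d g h :
  g =1 h -> polynomial_seq k d g -> polynomial_seq k d h.
Proof. by move=> /funext ->. Qed.

Lemma polynomial_seqW k d d' g :
  (d <= d')%N -> polynomial_seq k d' g -> polynomial_seq k d g.
Proof.
elim: k d d' g => [|k IH] d d' g le_d [gd dg].
  by split=> // m; exact: lower_centralW (gd m).
split.
- by move=> m; exact: lower_centralW (gd m).
- by apply: IH dg; rewrite leq_add2r.
Qed.

Lemma polynomial_seq_pred k d g :
  polynomial_seq k.+1 d g -> polynomial_seq k d g.
Proof.
elim: k d g => [|k IH] d g [gd dg]; split=> //; exact: IH.
Qed.

(** The three closure properties need one another: the shift quotients of products and inverses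
    involve conjugates, hence commutators, and those of commutators involve products. Simultaneous
    induction on [k], over all degrees, resolves this. *)
Lemma polynomial_seq_ring k :
  [/\ forall d g h, polynomial_seq k d g -> polynomial_seq k d h ->
        polynomial_seq k d (fun m => g m * h m),
      forall d g, polynomial_seq k d g -> polynomial_seq k d (fun m => (g m)^-1) &
      forall a b g h, polynomial_seq k a g -> polynomial_seq k b h ->
        polynomial_seq k (a + b) (fun m => [~ g m, h m])].
Proof.
have sL := @lower_central_subgroup G.
elim: k => [|k [IHM IHV IHR]].
  split=> [d g h [gd _] [hd _]|d g [gd _]|a b g h [ga _] [hb _]]; split=> // m.
  - exact: (subgroupM (sL d)).
  - exact: (subgroupV (sL d)).
  - exact: lower_central_commg.
(* Conjugation is multiplication by a commutator, whose degree is d + 0. *)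
have IHJ d g h : polynomial_seq k d g -> polynomial_seq k 0 h ->
    polynomial_seq k d (fun m => g m ^ h m).
  move=> gd h0; apply: (@eq_polynomial_seq _ _ (fun m => g m * [~ g m, h m])).
    by move=> m; free_group.
  by apply: IHM => //; rewrite -[d in polynomial_seq k d]addn0; apply: IHR.
have pred0 d g : polynomial_seq k.+1 d g -> polynomial_seq k 0 g.
  by move=> /polynomial_seq_pred; apply: polynomial_seqW.
have dqW d g : polynomial_seq k.+1 d g -> polynomial_seq k d (shift_quotient g).
  by move=> [_]; apply: polynomial_seqW; rewrite leq_addr.
split=> [d g h gP hP|d g gP|a b g h gP hP]; split.
- move=> m; apply: (subgroupM (sL d)); exact: polynomial_seq_val (_ : polynomial_seq k.+1 d _).
- case: (gP) (hP) => _ dg [_ dh].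
  apply: (@eq_polynomial_seq _ _ (fun m => shift_quotient g m ^ h m * shift_quotient h m)).
    by move=> m; rewrite /shift_quotient; free_group.
  by apply: IHM => //; apply: IHJ => //; exact: pred0 hP.
- by move=> m; apply: (subgroupV (sL d)); apply: polynomial_seq_val gP.
- case: (gP) => _ dg.
  apply: (@eq_polynomial_seq _ _ (fun m => (shift_quotient g m)^-1 ^ (g m)^-1)).
    by move=> m; rewrite /shift_quotient; free_group.
  by apply: IHJ; apply: IHV => //; exact: pred0 gP.
- move=> m; apply: lower_central_commg; [exact: polynomial_seq_val gP|exact: polynomial_seq_val hP].
- case: (gP) (hP) => _ dg [_ dh].
  set u := shift_quotient g; set v := shift_quotient h.
  have ga := polynomial_seq_pred gP; have hb := polynomial_seq_pred hP.
  have ua := dqW _ _ gP; have vb := dqW _ _ hP.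
  have u0 := polynomial_seqW (leq0n _) ua.
  have v0 := polynomial_seqW (leq0n _) vb.
  have cab := IHR _ _ _ _ ga hb.
  (* The shift quotient of [g, h]. In each of the three factors one entry is built from shift
     quotients, which supplies the additional degree [e]. *)
  apply: (@eq_polynomial_seq _ _ (fun m =>
    [~ g m * u m, v m] ^ [~ g m, h m] * [~ [~ g m, h m], u m * v m]
    * [~ u m, h m] ^ v m)).
    by move=> m; rewrite /u /v /shift_quotient; free_group.
  apply: (IHM); first apply: (IHM).
  - apply: (IHJ); last exact: polynomial_seqW (leq0n _) cab.
    by rewrite -addnA; apply: IHR => //; apply: IHM.
  - have uve : polynomial_seq k e (fun m => u m * v m).
      by apply: IHM; [apply: polynomial_seqW dg|apply: polynomial_seqW dh];
        rewrite leq_addl.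
    exact: IHR.
  - by apply: IHJ; rewrite // addnAC; apply: IHR.
Qed.

Lemma polynomial_seqM k d g h : polynomial_seq k d g -> polynomial_seq k d h ->
  polynomial_seq k d (fun m => g m * h m).
Proof. by have [+ _ _] := polynomial_seq_ring k; apply. Qed.

Lemma polynomial_seqV k d g : polynomial_seq k d g ->
  polynomial_seq k d (fun m => (g m)^-1).
Proof. by have [_ + _] := polynomial_seq_ring k; apply. Qed.

Lemma polynomial_seqR k a b g h : polynomial_seq k a g ->
  polynomial_seq k b h -> polynomial_seq k (a + b) (fun m => [~ g m, h m]).
Proof. by have [_ _ +] := polynomial_seq_ring k; apply. Qed.

Lemma polynomial_seq1 k d : polynomial_seq k d (fun=> 1).
Proof.
elim: k d => [|k IH] d.
  by split=> // _; exact: (subgroup1 (lower_central_subgroup d)).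
split=> [_|]; first exact: (subgroup1 (lower_central_subgroup d)).
by apply: eq_polynomial_seq (IH _) => m; rewrite /shift_quotient mulVg.
Qed.

Lemma polynomial_seq_const k d x : lc d x -> polynomial_seq k d (fun=> x).
Proof.
case: k => [|k] dx; split=> //.
by apply: eq_polynomial_seq (polynomial_seq1 _ _) => m; rewrite /shift_quotient mulVg.
Qed.

(** By Pascal's rule, the shift quotient replaces [s] by s - 1; the rise of the degree by [e] is
    paid for by the depth d + s e of [x]. *)
Lemma polynomial_seq_binomial k d s x :
  lc (d + s * e) x -> polynomial_seq k d (fun m => x ^+ 'C(m, s)).
Proof.
have xm d' m s' : lc (d' + s' * e) x -> lc d' (x ^+ m).
  move=> dx; apply: (subgroupX (lower_central_subgroup _)).
  by apply: lower_centralW dx; rewrite leq_addr.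
elim: k d s => [|k IH] d s dx; (split; first by move=> m; exact: xm dx) => //.
case: s dx => [|s] dx.
  apply: eq_polynomial_seq (polynomial_seq1 _ _) => m.
  by rewrite /shift_quotient !bin0 mulVg.
apply: (@eq_polynomial_seq _ _ (fun m => x ^+ 'C(m, s))).
  by move=> m; rewrite /shift_quotient binS expgnDr mulKg.
by apply: IH; rewrite -addnA -mulSn.
Qed.

Lemma polynomial_seq_expg k d x :
  lc (d + e) x -> polynomial_seq k d (fun m => x ^+ m).
Proof.
move=> dx; apply: (@eq_polynomial_seq _ _ (fun m => x ^+ 'C(m, 1))).
  by move=> m; rewrite bin1.
by apply: polynomial_seq_binomial; rewrite mul1n.
Qed.

(** Since g(s-1) = 1, the shift quotient takes the value g(s) at s - 1 and vanishes before; after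
    [s] such shifts the degree is d + s e. *)
Lemma polynomial_seq_leading k d s g : (s <= k)%N -> polynomial_seq k d g ->
  (forall m, (m < s)%N -> g m = 1) -> lc (d + s * e) (g s).
Proof.
elim: s k d g => [|s IH] [|k] d g //= le_sk [gd dg] g1; rewrite ?addn0 //.
have := IH k (d + e)%N (shift_quotient g) le_sk dg.
rewrite -addnA -mulSn /shift_quotient g1 // invg1 mul1g; apply.
by move=> m lt_ms; rewrite !g1 ?mulVg // ltnW.
Qed.

(* Subtracting from g the terms g(s)^C(m,s) one by one, as in Newton
   interpolation, leaves a sequence vanishing at q. *)
Lemma polynomial_seq_subgroup (U : set G) q d s g : is_subgroup U ->
  (forall k, polynomial_seq k d g) ->
  (forall m, (m < s)%N -> g m = 1) ->
  (forall k c, (s <= k <= q)%N -> lc (d + k * e) c -> U (c ^+ 'C(q, k))) ->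
  U (g q).
Proof.
move=> sU; move eqt: (q.+1 - s)%N => t.
elim: t s eqt g => [|t IH] s eqt g gP g1 UC.
  by rewrite g1; [exact: (subgroup1 sU)|rewrite -subn_eq0 eqt].
have le_sq : (s <= q)%N by rewrite -ltnS -subn_gt0 eqt.
have gs : lc (d + s * e) (g s) by apply: polynomial_seq_leading (gP s) g1.
apply: (subgroupMl sU (x := (g s ^+ 'C(q, s))^-1)).
  by apply: (subgroupV sU); apply: UC; rewrite ?leqnn.
apply: (IH s.+1 _ (fun m => (g s ^+ 'C(m, s))^-1 * g m)).
- by rewrite subnS eqt.
- move=> k; apply: polynomial_seqM => //; apply: polynomial_seqV.
  exact: polynomial_seq_binomial.
- move=> m; rewrite ltnS leq_eqVlt => /predU1P[->|lt_ms].
    by rewrite binn expg1 mulVg.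
  by rewrite bin_small // (g1 m) // mulg1 expg0 invg1.
- by move=> k c /andP[/ltnW sk kq]; apply: UC; rewrite sk.
Qed.

End PolynomialSequences.

(** * Powers of products and of commutators *)

Section HallPetrescu.
Variables (G : topologicalGroupType) (U : set G) (q i : nat).
Hypothesis sU : is_subgroup U.
Notation lc := (@lower_central G).

(** The sequence (xy)^m (x^m y^m)^-1 has degree 0 with increment e = i. It is trivial at m = 0, 1,
    so its interpolation starts at k = 2. *)
Lemma expgM_mod x y : lc i x -> lc i y ->
  (forall k c, (1 < k <= q)%N -> lc (k * i) c -> U (c ^+ 'C(q, k))) ->
  U (x ^+ q) -> U (y ^+ q) -> U ((x * y) ^+ q).
Proof.
move=> ix iy UC Ux Uy; apply: (subgroupMr sU (y := (y ^+ q)^-1 * (x ^+ q)^-1)).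
  by apply: (subgroupM sU); apply: (subgroupV sU).
rewrite -invgM; apply: (@polynomial_seq_subgroup _ i U q 0 2
  (fun m => (x * y) ^+ m * (x ^+ m * y ^+ m)^-1)) => //.
- move=> k; apply: polynomial_seqM; last apply: polynomial_seqV.
    apply: polynomial_seq_expg; exact: (subgroupM (lower_central_subgroup _)).
  by apply: polynomial_seqM; apply: polynomial_seq_expg.
- case=> [|[|m]] // _; first by rewrite !expg0 mulg1 mulgV.
  by rewrite !expg1 mulgV.
Qed.

(** Interpolation of [b,a]^m [b^m,a]^-1. The constant [a] has degree 1, which makes the whole
    sequence of degree 1 and accounts for the successor in [(k * i).+1]. *)
Lemma expg_commg_mod a b : lc i b ->
  (forall k c, (1 < k <= q)%N -> lc (k * i).+1 c -> U (c ^+ 'C(q, k))) ->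
  U [~ b ^+ q, a] -> U ([~ b, a] ^+ q).
Proof.
move=> ib UC Uba; apply: (subgroupMr sU (subgroupV sU Uba)).
apply: (@polynomial_seq_subgroup _ i U q 1 2
  (fun m => [~ b, a] ^+ m * [~ b ^+ m, a]^-1)) => //.
- move=> k; apply: polynomial_seqM; last apply: polynomial_seqV.
    apply: polynomial_seq_expg; rewrite add1n.
    by apply: (subgroup_invR (lower_central_subgroup _)); apply: mem_lower_centralS.
  apply: (@polynomial_seqR _ i k 0 1 (fun m => b ^+ m) (fun=> a)).
    exact: polynomial_seq_expg.
  exact: polynomial_seq_const.
- case=> [|[|m]] // _; first by rewrite !expg0 comm1g mulgV.
  by rewrite !expg1 mulgV.
Qed.

End HallPetrescu.

(** For k <= p^j, take s = j - v_p(k): p^j divides k C(p^j, k), and the p-part of k is at most k.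
    For larger k the binomial coefficient is 0 and s = 0 works. *)
Lemma pfactor_dvd_bin p j k : prime p -> (0 < k)%N ->
  exists2 s, (p ^ s %| 'C(p ^ j, k))%N & (p ^ j <= k * p ^ s)%N.
Proof.
move=> p_pr k0; have p0 := prime_gt0 p_pr.
have [le_kq|lt_qk] := leqP k (p ^ j); last first.
  by exists 0; rewrite ?dvd1n // muln1 ltnW.
exists (j - logn p k)%N.
  have C0 : (0 < 'C(p ^ j, k))%N by rewrite bin_gt0.
  rewrite pfactor_dvdn // leq_subLR -lognM // -pfactor_dvdn ?muln_gt0 ?k0 //.
  by case: k k0 {le_kq C0} => // k _; rewrite -mul_bin_diag dvdn_mulr.
apply: leq_trans (_ : p ^ logn p k * p ^ (j - logn p k) <= _)%N.
  by rewrite -expnD leq_pexp2l // -leq_subLR.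
by rewrite leq_mul2r dvdn_leq ?orbT // pfactor_dvdnn.
Qed.

(** * Bilinearity and Jacobi identity modulo the next lower central term *)

Section CommutatorModulo.
Variables (G : topologicalGroupType) (m : nat) (K : set G).
Notation lc := (@lower_central G).
Hypotheses (sK : is_subgroup K) (cK : closed K) (lcK : lc m.+1 `<=` K).

Variables (a b : nat) (y : G).
Hypotheses (abm : (a + b)%N = m) (by_ : lc b y).

(** On G^(a), the map x |-> [x, y] is a homomorphism modulo G^(m+1), which [K] contains. So this is
    a closed subgroup, and [x, y] in [K] may be tested on topological generators. *)
Definition commg_preimage : set G := lc a `&` [set x | K [~ x, y]].

Lemma commg_preimage_conj x z : commg_preimage x -> commg_preimage (x ^ z).
Proof.
move=> [ax Kx]; split; first exact: lower_central_conj.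
rewrite /= (_ : [~ x ^ z, y] = [~ x, y] * ([~ [~ x, y], [~ x, z]] * [~ [~ x, z], y]));
  last free_group.
have xy : lc m [~ x, y] by rewrite -abm; apply: lower_central_commg.
have xz : lc a.+1 [~ x, z].
  by apply: (subgroup_invR (lower_central_subgroup _)); apply: mem_lower_centralS.
apply: (subgroupM sK) => //; apply: lcK.
apply: (subgroupM (lower_central_subgroup _)); last first.
  by rewrite -abm -addSn; apply: lower_central_commg.
by apply: (subgroup_invR (lower_central_subgroup _)); apply: mem_lower_centralS.
Qed.

Lemma commg_preimage_subgroup : is_subgroup commg_preimage.
Proof.
have sa := lower_central_subgroup (G := G) a.
have xyz x z : commg_preimage x -> K ([~ x, y] ^ z).
  move=> [ax Kx]; rewrite (_ : _ ^ z = [~ x, y] * [~ [~ x, y], z]); last free_group.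
  apply: (subgroupM sK) => //; apply/lcK.
  apply: (subgroup_invR (lower_central_subgroup _)); apply: mem_lower_centralS.
  by rewrite -abm; apply: lower_central_commg.
split.
- by split; [exact: (subgroup1 sa)|rewrite /= comm1g; exact: (subgroup1 sK)].
- move=> x z xP [az Kz]; split; first by apply: (subgroupM sa) => //; case: xP.
  rewrite /= (_ : [~ _, _] = [~ x, y] ^ z * [~ z, y]); last free_group.
  by apply: (subgroupM sK) => //; exact: xyz.
- move=> x xP; split; first by apply: (subgroupV sa); case: xP.
  rewrite /= (_ : [~ _, _] = ([~ x, y] ^ x^-1)^-1); last free_group.
  by apply: (subgroupV sK); exact: xyz.
Qed.

Lemma commg_preimage_closed : closed commg_preimage.
Proof.
apply: closedI; first exact: lower_central_closed.
exact: (closed_preimage (@continuous_commgl G y) cK).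
Qed.

Lemma commg_preimage_lower_central : lc a.+1 `<=` commg_preimage.
Proof.
move=> x xP; split; first exact: lower_centralS.
by apply: lcK; rewrite -abm -addSn; apply: lower_central_commg.
Qed.

Lemma commg_closed_gen A : (forall x, A x -> commg_preimage x) ->
  forall x, closed_gen A x -> K [~ x, y].
Proof.
move=> AP x xA; suff [] : commg_preimage x by [].
move: x xA; apply: closed_gen_min => //.
  exact: commg_preimage_subgroup.
exact: commg_preimage_closed.
Qed.

End CommutatorModulo.

Section JacobiModulo.
Variables (G : topologicalGroupType) (i j k : nat) (K : set G).
Notation lc := (@lower_central G).
Hypotheses (sK : is_subgroup K) (lcK : lc (i + j + k).+1 `<=` K).

(** The Hall-Witt identity, read modulo [K]. The conjugations and inverses in it are harmless,
    because elements of weight i + j + k are central modulo the next term. *)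
Lemma commg_jacobi_mod x y z : lc i x -> lc j y -> lc k z ->
  K [~ [~ x, z], y] -> K [~ x, [~ y, z]] -> K [~ [~ x, y], z].
Proof.
move=> ix jy kz xzy xyz.
pose P a w := commg_preimage K a w.
have PJ a b w u v : (a + b)%N = (i + j + k)%N -> lc b w ->
    lc a u -> K [~ u, w] -> K [~ u^-1 ^ v, w] /\ K [~ u ^ v, w].
  move=> ab bw au Kuw; have uP : P a w u by [].
  have sP := commg_preimage_subgroup sK lcK ab bw.
  split; last by case: (commg_preimage_conj sK lcK ab bw v uP).
  by case: (commg_preimage_conj sK lcK ab bw v (subgroupV sP uP)).
have KJ u v : lc (i + j + k) u -> K u -> K (u ^ v).
  move=> mu Ku; rewrite (_ : u ^ v = u * [~ u, v]); last free_group.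
  apply: (subgroupM sK) => //; apply: lcK.
  by apply: (subgroup_invR (lower_central_subgroup _)); apply: mem_lower_centralS.
have sL := @lower_central_subgroup G.
have lcR a b c u v : lc a u -> lc b v -> (a + b)%N = c -> lc c [~ u, v].
  by move=> au bv <-; apply: lower_central_commg.
have [xV yV zV] : [/\ lc i x^-1, lc j y^-1 & lc k z^-1].
  by split; apply: (subgroupV (sL _)).
have zxyL : lc (i + j + k) [~ [~ z, x^-1], y].
  by apply: (lcR (k + i)%N j) => //; [apply: (lcR k i)|rewrite -addnA addnC].
have yzxL : lc (i + j + k) [~ [~ y, z^-1], x].
  by apply: (lcR (j + k)%N i) => //; [apply: (lcR j k)|rewrite addnC addnA].
have zxy : K [~ [~ z, x^-1], y].
  rewrite (_ : [~ z, x^-1] = [~ x, z] ^ x^-1); last free_group.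
  apply: (PJ (i + k)%N j y [~ x, z] x^-1 _ jy _ xzy).2; first by rewrite addnAC.
  exact: (lcR i k).
have yzx : K [~ [~ y, z^-1], x].
  rewrite (_ : [~ y, z^-1] = [~ y, z]^-1 ^ z^-1); last free_group.
  apply: (PJ (j + k)%N i x [~ y, z] z^-1 _ ix _ _).1.
  - by rewrite addnC addnA.
  - exact: (lcR j k).
  - exact: (subgroup_invR sK).
have xyz' : K [~ [~ x, y^-1], z].
  rewrite (_ : [~ _, _] =
    ([~ [~ y, z^-1], x] ^ z * [~ [~ z, x^-1], y] ^ x)^-1 ^ y^-1); last free_group.
  apply: (KJ).
    apply: (subgroupV (sL _)).
    by apply: (subgroupM (sL _)); apply: lower_central_conj.
  by apply: (subgroupV sK); apply: (subgroupM sK); apply: (KJ).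
(* Hall-Witt gave the statement for [y^-1]; this passes to [y]. *)
rewrite (_ : [~ x, y] = [~ x, y^-1]^-1 ^ y); last free_group.
apply: (PJ (i + j)%N k z [~ x, y^-1] y _ kz _ _).1 => //.
exact: (lcR i j).
Qed.

End JacobiModulo.

(** * Finite enumeration of trees *)

HB.instance Definition _ (X : Type) := gen_eqMixin (free_magma X).

Lemma size_foliage_gt0 (X : Type) (h : free_magma X) : (0 < size (foliage h))%N.
Proof. by elim: h => [//|h' IH h'' _] /=; rewrite size_cat addn_gt0 IH. Qed.

(** Enumerates by height, which never exceeds the degree. This gives a finite list in which Hall
    trees can be counted, although the order on a Hall set need not be well-founded. *)
Fixpoint trees (X : Type) (s : seq X) (m : nat) : seq (free_magma X) :=
  if m is m'.+1 then
    map (@Letter X) s ++ allpairs (@Bracket X) (trees s m') (trees s m')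
  else [::].

Lemma mem_trees (X : eqType) (s : seq X) m (h : free_magma X) :
  (size (foliage h) <= m)%N -> {subset foliage h <= s} -> h \in trees s m.
Proof.
elim: m h => [|m IH] h le_m sh.
  by have := size_foliage_gt0 h; rewrite leqNgt ltnS le_m.
rewrite mem_cat; case: h le_m sh => [x|h' h''] /= le_m sh.
  by rewrite map_f //; apply: sh; rewrite inE.
have := size_foliage_gt0 h'; have := size_foliage_gt0 h''.
move: le_m; rewrite size_cat => le_m h'0 h''0.
rewrite allpairs_f ?orbT //; apply: IH.
- by rewrite -ltnS; apply: leq_trans le_m; rewrite -[ltnLHS]addn0 ltn_add2l.
- by move=> x xh; apply: sh; rewrite mem_cat xh.
- by rewrite -ltnS; apply: leq_trans le_m; rewrite -[ltnLHS]add0n ltn_add2r.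
- by move=> x xh; apply: sh; rewrite mem_cat xh orbT.
Qed.

Lemma ltn_count (T : eqType) (a b : pred T) (s : seq T) x :
  subpred a b -> x \in s -> b x -> ~~ a x -> (count a s < count b s)%N.
Proof.
move=> sab + bx nax; elim: s => //= y s IH.
rewrite inE => /predU1P[<-|xs].
  by rewrite (negbTE nax) bx add0n add1n ltnS sub_count.
rewrite -addnS leq_add ?IH //.
by have := sab y; case: (a y) => // ->.
Qed.

(** * Hall commutators generate the lower central quotients *)

Section HallGeneration.
Variables (d : Order.disp_t) (X : orderType d) (G : topologicalGroupType).
Variables (iota : X -> G) (HH : set (free_magma X)).
Variable le : free_magma X -> free_magma X -> Prop.
Hypothesis hallH : is_hall_set HH le.
Notation lc := (@lower_central G).
Notation deg h := (size (foliage h)).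
Notation tau_tree := (tau_tree iota).

Lemma tau_tree_lower_central h : lc (deg h) (tau_tree h).
Proof.
elim: h => [//|h' IH' h'' IH''] /=; rewrite size_cat.
exact: lower_central_commg.
Qed.

Definition hall_lt h k := le h k /\ h <> k.

Lemma hall_lt_trans h k l : HH h -> HH k -> HH l ->
  hall_lt h k -> hall_lt k l -> hall_lt h l.
Proof.
move=> Hh Hk Hl [hk nhk] [kl nkl]; split; first exact: (hall_le_trans hallH) hk kl.
by move=> hl; apply: nhk; apply: (hall_le_anti hallH) => //; rewrite hl.
Qed.

Lemma hall_le_lt_trans h k l : HH h -> HH k -> HH l ->
  le h k -> hall_lt k l -> hall_lt h l.
Proof.
move=> Hh Hk Hl hk kl; have [->//|/eqP nhk] := eqVneq h k.
exact: (hall_lt_trans Hh Hk Hl _ kl).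
Qed.

Lemma hall_lt_total h k : HH h -> HH k -> [\/ h = k, hall_lt h k | hall_lt k h].
Proof.
move=> Hh Hk; have [->|/eqP nhk] := eqVneq h k; first exact: Or31.
by case: (hall_le_total hallH Hh Hk) => ?; [apply: Or32|apply: Or33];
  split=> // /esym.
Qed.

(** The bound on the right factor is the invariant of the rewriting: it forces such a tree to be
    smaller than [v]. The finite alphabet [s] makes the induction on [v] terminate. *)
Definition hall_below (s : seq X) m v : set (free_magma X) :=
  [set h | [/\ HH h, deg h = m, {subset foliage h <= s} &
    exists h' h'', h = Bracket h' h'' /\ le h'' v]].

Definition hall_span s m v : set G :=
  closed_gen (lc m.+1 `|` [set tau_tree h | h in hall_below s m v]).

Lemma hall_span_lower_central s m v : lc m.+1 `<=` hall_span s m v.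
Proof. by move=> x lcx; apply: mem_closed_gen; left. Qed.

Lemma hall_span_le s m v w : HH v -> HH w -> le v w ->
  hall_span s m v `<=` hall_span s m w.
Proof.
move=> Hv Hw vw; apply: closed_gen_min.
- exact: closed_gen_subgroup.
- exact: closed_gen_closed.
move=> x [lcx|[h [Hh dh sh [h' [h'' [defh h''v]]]] <-]]; apply: mem_closed_gen.
  by left.
right; exists h => //; split=> //; exists h', h''; split=> //.
move: Hh; rewrite defh => /(hall_right hallH)[Hh'' _].
exact: (hall_le_trans hallH) h''v vw.
Qed.

(** As h < h'' <= v and u < v, the larger of [h] and [u] is a bound smaller than [v], to which the
    assumed case applies. *)
Lemma hall_span_lt s m m' v u h : HH v -> HH u -> hall_below s m' v h ->
  (forall a b w, HH a -> HH b -> HH w -> hall_lt w v ->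
    {subset foliage a <= s} -> {subset foliage b <= s} ->
    (deg a + deg b)%N = m -> le a w -> le b w ->
    hall_span s m w [~ tau_tree a, tau_tree b]) ->
  hall_lt u v -> {subset foliage u <= s} -> (m' + deg u)%N = m ->
  hall_span s m v [~ tau_tree h, tau_tree u].
Proof.
move=> Hv Hu [Hh dh sh [h' [h'' [defh h''v]]]] IH uv su dm.
have hv : hall_lt h v.
  move: (Hh); rewrite {1}defh => /(hall_right hallH)[Hh'' hh''].
  move: hh''; rewrite -defh => hh''.
  split; first exact: (hall_le_trans hallH) hh''.1 h''v.
  move=> ehv; apply: hh''.2; apply: (hall_le_anti hallH) => //; first exact: hh''.1.
  by rewrite ehv.
have [hu|uh] := hall_le_total hallH Hh Hu.
- apply: (hall_span_le Hu Hv uv.1); apply: IH => //; first by rewrite dh.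
  exact: (hall_le_refl hallH).
- apply: (hall_span_le Hh Hv hv.1); apply: IH => //; first by rewrite dh.
  exact: (hall_le_refl hallH).
Qed.

(* Reutenauer's rewriting: if (u v) with u = (u1 u2) is not in HH, then u2 < v,
   and the Jacobi identity replaces [u, v] by [[u1, v], u2] and [u1, [u2, v]],
   in which both arguments are now smaller than v. *)
Lemma hall_commg s v u : HH u -> HH v -> hall_lt u v ->
  {subset foliage u <= s} -> {subset foliage v <= s} ->
  hall_span s (deg u + deg v) v [~ tau_tree u, tau_tree v].
Proof.
move eqm: (deg u + deg v)%N => m.
elim/ltn_ind: m u v eqm => m IHm u v.
(* Inner induction for fixed degree: the rank drops when [v] is replaced by a smaller Hall tree from
   the list. *)
pose rank w := count (fun h => `[< HH h /\ hall_lt h w >]) (trees s m).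
move eqr: (rank v) => r; elim/ltn_ind: r u v eqr => r IHr u v eqr eqm.
move=> Hu Hv uv su sv.
have IHle a b w : HH a -> HH b -> HH w -> hall_lt w v ->
    {subset foliage a <= s} -> {subset foliage b <= s} ->
    (deg a + deg b)%N = m -> le a w -> le b w ->
    hall_span s m w [~ tau_tree a, tau_tree b].
  move=> Ha Hb Hw wv sa sb dab aw bw.
  have IHb a' b' : HH a' -> HH b' -> hall_lt a' b' -> le b' w ->
      {subset foliage a' <= s} -> {subset foliage b' <= s} ->
      (deg a' + deg b')%N = m -> hall_span s m w [~ tau_tree a', tau_tree b'].
    move=> Ha' Hb' ab' b'w sa' sb' dab'.
    have b'v := hall_le_lt_trans Hb' Hw Hv b'w wv.
    apply: (hall_span_le Hb' Hw b'w); apply: (IHr (rank b')) => //.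
    rewrite -eqr /rank; apply: (@ltn_count _ _ _ _ b').
    - move=> h /asboolP[Hh hb']; apply/asboolP; split=> //.
      exact: hall_lt_trans hb' b'v.
    - by apply: mem_trees => //; rewrite -dab' leq_addl.
    - exact/asboolP.
    - by apply/asboolP => -[_ [_]].
  case: (hall_lt_total Ha Hb) => [->|ab|ba].
  - rewrite commgg; exact: (subgroup1 (closed_gen_subgroup _)).
  - exact: IHb.
  - apply: (subgroup_invR (closed_gen_subgroup _)); apply: IHb => //.
    by rewrite addnC.
have sK := closed_gen_subgroup
  (lc m.+1 `|` [set tau_tree h | h in hall_below s m v]).
(* The outer induction expands [a, v] into Hall trees with right factor at most [v]; [hall_span_lt]
   then handles the bracket of each with [b]. *)
have IHspan a b : HH a -> HH b -> (deg a + deg v + deg b)%N = m ->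
    {subset foliage a <= s} -> {subset foliage b <= s} ->
    hall_lt a v -> hall_lt b v ->
    hall_span s m v [~ [~ tau_tree a, tau_tree v], tau_tree b].
  move=> Ha Hb dm sa sb av bv.
  have lt_m : (deg a + deg v < m)%N.
    by rewrite -dm -[ltnLHS]addn0 ltn_add2l size_foliage_gt0.
  have lcb := tau_tree_lower_central b.
  apply: (commg_closed_gen sK (@closed_gen_closed _ _)
    (@hall_span_lower_central s m v) dm lcb) (IHm _ lt_m _ _ erefl Ha Hv av sa sv).
  move=> x [|[h hP <-]].
    exact: (commg_preimage_lower_central (@hall_span_lower_central s m v) dm lcb).
  split; first by case: (hP) => _ <- _ _; exact: tau_tree_lower_central.
  exact: hall_span_lt hP IHle bv sb dm.
have [Huv|nHuv] := pselect (HH (Bracket u v)).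
  apply: mem_closed_gen; right; exists (Bracket u v) => //.
  split=> //=; first by rewrite size_cat.
    by move=> x; rewrite mem_cat => /orP[/su|/sv].
  by exists u, v; split=> //; exact: (hall_le_refl hallH).
case: u Hu uv su eqm nHuv => [x|u1 u2] Hu uv su eqm nHuv.
  by case: nHuv; apply/(hall_bracket hallH); split=> //; left; exists x.
have [Hu1 Hu2 u12 _] := (hall_bracket hallH _ _).1 Hu.
have u2v : hall_lt u2 v.
  case: (hall_lt_total Hu2 Hv) => // [eu|vu]; case: nHuv;
    apply/(hall_bracket hallH); split=> //; right; exists u1, u2; split=> //.
    by rewrite eu; exact: (hall_le_refl hallH).
  exact: vu.1.
have u1v := hall_lt_trans Hu1 Hu2 Hv u12 u2v.
have su1 : {subset foliage u1 <= s} by move=> x xu; apply: su; rewrite mem_cat xu.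
have su2 : {subset foliage u2 <= s}.
  by move=> x xu; apply: su; rewrite mem_cat xu orbT.
rewrite /= size_cat in eqm.
apply: (commg_jacobi_mod (i := deg u1) (j := deg u2) (k := deg v) sK) => //.
- by rewrite eqm; exact: hall_span_lower_central.
- exact: tau_tree_lower_central.
- exact: tau_tree_lower_central.
- exact: tau_tree_lower_central.
- by apply: IHspan; rewrite // addnAC.
- by apply: (subgroup_invR sK); apply: IHspan; rewrite // -eqm addnC addnA.
Qed.

(** By bilinearity, brackets of a letter with a Hall tree of degree i - 1 generate G^(i) modulo
    G^(i+1) when i > 1; [hall_commg] expands them. *)
Lemma lower_central_hall i : (0 < i)%N -> closed_gen (range iota) = [set: G] ->
  lc i `<=` closed_gen (lc i.+1 `|` [set tau_tree h | h in [set h | HH h /\ deg h = i]]).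
Proof.
move=> + iotaG; elim: i => // -[|i] IH _.
  rewrite /= -{1}iotaG; apply: closed_gen_min.
  - exact: closed_gen_subgroup.
  - exact: closed_gen_closed.
  move=> _ [x _ <-]; apply: mem_closed_gen; right; exists (Letter x) => //.
  by split=> //; exact: (hall_letter hallH).
set B := closed_gen _.
have sB : is_subgroup B by exact: closed_gen_subgroup.
have cB : closed B by exact: closed_gen_closed.
have lcB : lc i.+3 `<=` B by move=> x lcx; apply: mem_closed_gen; left.
apply: closed_gen_min => // _ [g _ [y lcy <-]].
have : closed_gen (range iota) g by rewrite iotaG.
apply: (commg_closed_gen sB cB lcB (a := 1) (b := i.+1)) => //.
move=> _ [x _ <-]; split=> //=; apply: (subgroup_invR sB).
apply: (commg_closed_gen sB cB lcB (a := i.+1) (b := 1)) (IH isT _ lcy) => //.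
  by rewrite addn1.
move=> {}g [lcg|[h [Hh dh] <-]].
  by apply: (commg_preimage_lower_central lcB (b := 1)) => //; rewrite addn1.
split; first by rewrite -dh; exact: tau_tree_lower_central.
have Hx := hall_letter hallH x.
have spanB s v : hall_span s i.+2 v `<=` B.
  apply: closed_gen_min => // z [lcz|[k [Hk dk _ _] <-]]; first exact: lcB.
  by apply: mem_closed_gen; right; exists k.
(* The finite alphabet consists of the letters of the two trees at hand. *)
have sx : {subset [:: x] <= x :: foliage h}.
  by move=> z; rewrite !inE => ->.
have sh : {subset foliage h <= x :: foliage h}.
  by move=> z zh; rewrite inE zh orbT.
have [->|hx|xh] := hall_lt_total Hh Hx.
- by rewrite /= commgg; exact: (subgroup1 sB).
- apply: (spanB (x :: foliage h) (Letter x)).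
  have := hall_commg Hh Hx hx sh sx.
  by rewrite dh /= addn1.
- apply: (subgroup_invR sB); apply: (spanB (x :: foliage h) h).
  by have := hall_commg Hx Hh xh sx sh; rewrite dh.
Qed.

End HallGeneration.

(** * The Zassenhaus filtration and powers of lower central terms *)

Section Zassenhaus.
Variables (G : topologicalGroupType) (p n : nat).
Notation lc := (@lower_central G).
Notation zas := (@zassenhaus G n p).

Lemma mem_zassenhaus i j x : (0 < i)%N -> (n <= i * p ^ j)%N -> lc i x ->
  zas (x ^+ (p ^ j)).
Proof.
move=> i0 nij lcx; apply: mem_closed_gen; exists (i, j) => //.
exact: mem_closed_power.
Qed.

Lemma zassenhaus_normal : is_normal_subgroup zas.
Proof.
apply: closed_gen_normal => x y [ij ijP xP]; exists ij => //.
by apply: (closed_power_normal _ _).2 xP; exact: lower_central_normal.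
Qed.

End Zassenhaus.

Section PowersOfLowerCentral.
Variables (G : topologicalGroupType) (p n : nat) (U : set G) (T : nat -> set G).
Notation lc := (@lower_central G).
Notation zas := (@zassenhaus G n p).
Hypotheses (p_pr : prime p) (n_gt0 : (0 < n)%N).
Hypotheses (sU : is_subgroup U) (cU : closed U).
Hypothesis Upow : forall x, zas x -> U (x ^+ p).
Hypothesis Ucomm : forall x y, zas y -> U [~ x, y].
Hypothesis lcT : forall i, (0 < i)%N -> lc i `<=` closed_gen (lc i.+1 `|` T i).
Hypothesis T_lc : forall i, T i `<=` lc i.
Hypothesis UT : forall i x, J_set p n i -> T i x -> U (x ^+ (p ^ j_index p n i)).

(* Descending induction on i: by Hall-Petrescu, x |-> x^(p^j) is multiplicative
   on G^(i) modulo U, so it suffices to treat generators of G^(i). If j is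
   minimal, then either i = ceil (n / p^j) is in J(n), or (i-1) p^j >= n and
   [b, a]^(p^j) is congruent to [b^(p^j), a] for b in G^(i-1). *)
Lemma lower_central_powers i j x : (0 < i)%N -> (n <= i * p ^ j)%N -> lc i x ->
  U (x ^+ (p ^ j)).
Proof.
have p_gt0 := prime_gt0 p_pr.
move eqt: (n.+1 - i)%N => t; elim/ltn_ind: t i eqt j x => t IH i eqt j x i0 nij lcx.
(* Start of the descending induction: for i > n, G^(i) lies in [G, G^(n)], and G^(n) lies in the
   Zassenhaus subgroup. *)
have [lt_ni|le_in] := ltnP n i.
  apply: (subgroupX sU); have := lower_centralW lt_ni lcx.
  case: (n) n_gt0 Ucomm => [//|m] _ UC; apply: closed_gen_min => //.
  move=> _ [g _ [y lcy <-]]; apply: UC; rewrite -[y]expg1.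
  by apply: (@mem_zassenhaus _ p _ m.+1 0); rewrite ?expn0 ?muln1.
have IHi i' j' y : (i < i')%N -> (n <= i' * p ^ j')%N -> lc i' y ->
    U (y ^+ (p ^ j')).
  move=> ii'; apply: (IH (n.+1 - i')%N) => //; last exact: leq_trans ii'.
  by rewrite -eqt ltn_sub2l // ltnS.
(* Disposes of the Hall-Petrescu correction terms: c^C(p^j,k) is a power of c^(p^s), where p^j <= k
   p^s, and [c] lies deeper than [i]. *)
have UC k i' c : (0 < k)%N -> (i < i')%N ->
    (forall s, (p ^ j <= k * p ^ s)%N -> (n <= i' * p ^ s)%N) ->
    lc i' c -> U (c ^+ 'C(p ^ j, k)).
  move=> k0 ii' ns lcc; have [s /dvdnP[r ->] kps] := pfactor_dvd_bin j p_pr k0.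
  by rewrite mulnC expgnA; apply: (subgroupX sU); apply: (IHi i') => //; apply: ns.
(* If [j] is not minimal, x^(p^j) is the p-th power of an element of the Zassenhaus subgroup. *)
have [[j' eqj nj']|jmin] := pselect (exists2 j', j = j'.+1 & (n <= i * p ^ j')%N).
  by rewrite eqj expnSr expgnA; apply: Upow; apply: mem_zassenhaus nj' lcx.
have jE : j = j_index p n i.
  apply/eqP; rewrite eqn_leq j_index_leq // nij andbT.
  rewrite leqNgt; apply/negP => lt_ij; apply: jmin.
  by exists j.-1; [rewrite (ltn_predK lt_ij)|rewrite -j_index_leq // -ltnS (ltn_predK lt_ij)].
pose M := lc i `&` [set y | U (y ^+ (p ^ j))].
have sL := lower_central_subgroup (G := G) i.
have sM : is_subgroup M.
  split.
  - by split; [exact: (subgroup1 sL)|rewrite /= expg1n; exact: (subgroup1 sU)].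
  - move=> y z [lcy Uy] [lcz Uz]; split; first exact: (subgroupM sL).
    apply: (@expgM_mod _ _ _ i) => // k c /andP[k1 _] lcc.
    apply: (UC k (k * i)%N) => //; first exact: ltnW.
      by rewrite -[ltnLHS]mul1n ltn_mul2r i0.
    move=> s kps; apply: leq_trans nij _; rewrite mulnAC mulnC.
    by rewrite leq_mul2r kps orbT.
  - move=> y [lcy Uy]; split; first exact: (subgroupV sL).
    by rewrite /= expVgn; exact: (subgroupV sU).
have cM : closed M.
  apply: closedI; first exact: lower_central_closed.
  exact: (closed_preimage (@continuous_expg G (p ^ j)) cU).
suff lcM : lc i `<=` M by case: (lcM x lcx).
have [Ji|nJi] := pselect (J_set p n i).
  apply: subset_trans (lcT i0) _; apply: closed_gen_min => // y [lcy|Ty].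
    split; first exact: lower_centralS.
    apply: IHi lcy => //; apply: leq_trans nij _.
    by rewrite leq_mul2r leqnSn orbT.
  by split; [exact: T_lc|rewrite /= jE; exact: UT].
have ni1 : (n <= i.-1 * p ^ j)%N.
  have pj0 : (0 < p ^ j)%N by rewrite expn_gt0 p_gt0.
  have := nij; rewrite mulnC -ceil_div_leq // leq_eqVlt => /predU1P[ei|].
    by case: nJi; split; [rewrite i0|exists j].
  by move=> lt_i; rewrite mulnC -ceil_div_leq // -ltnS (prednK i0).
(* The value i = 1 would force n <= 0, so i = e + 2. *)
case: i i0 {IH eqt nij lcx jmin jE sL nJi} @M sM cM le_in IHi UC ni1 => [//|[|e]] _ M sM cM _ _ UC ni1.
  by move: ni1; rewrite mul0n leqNgt n_gt0.
apply: closed_gen_min => // _ [a _ [b lcb <-]].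
apply: (subgroup_invR sM); split.
  by apply: (subgroup_invR (lower_central_subgroup _)); exact: mem_lower_centralS.
apply: (@expg_commg_mod _ _ _ e.+1) => //.
  move=> k c /andP[k1 _] lcc; apply: (UC k (k * e.+1).+1) => //; first exact: ltnW.
    (* Since k >= 2, the depth k(i-1) + 1 exceeds i. *)
    rewrite ltnS; apply: leq_trans (_ : 2 * e.+1 <= _)%N; last by rewrite leq_mul2r k1 orbT.
    by rewrite mul2n -addnn addSn ltnS addnS ltnS leq_addr.
  move=> s kps; apply: leq_trans ni1 _; rewrite mulSn; apply: leq_trans (leq_addl _ _).
  by rewrite mulnAC mulnC leq_mul2r kps orbT.
apply: (subgroup_invR sU); apply: Ucomm.
exact: mem_zassenhaus ni1 lcb.
Qed.

Lemma zassenhaus_sub : zas `<=` U.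
Proof.
apply: closed_gen_min => // x [[i j] /= [i0 nij]].
apply: closed_gen_min => // _ [y lcy <-].
exact: lower_central_powers lcy.
Qed.

End PowersOfLowerCentral.

(** * Cosets and closed subgroups of the quotient *)

Section Cosets.
Variables (G : topologicalGroupType) (N : set G).
Hypothesis nN : is_normal_subgroup N.
Let sN : is_subgroup N := nN.1.

Lemma left_coset1 : left_coset N 1 = N.
Proof.
apply/seteqP; split=> [_ [y Ny <-]|y Ny]; first by rewrite mul1g.
by exists y => //; rewrite mul1g.
Qed.

Lemma left_coset_mem x : N x -> left_coset N x = N.
Proof.
move=> Nx; apply/seteqP; split=> [_ [y Ny <-]|y Ny]; first exact: (subgroupM sN).
by exists (x^-1 * y); [apply: (subgroupM sN) => //; exact: (subgroupV sN)|rewrite mulVKg].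
Qed.

Lemma left_cosetM x y :
  set_mulg (left_coset N x) (left_coset N y) = left_coset N (x * y).
Proof.
apply/seteqP; split=> [_ [_ [a Na <-] [_ [b Nb <-] <-]]|_ [a Na <-]].
  exists (a ^ y * b); last by free_group.
  by apply: (subgroupM sN) => //; exact: nN.2.
exists x; first by exists 1; [exact: (subgroup1 sN)|rewrite mulg1].
by exists (y * a); [exists a|rewrite mulgA].
Qed.

Lemma left_cosetV x : set_invg (left_coset N x) = left_coset N x^-1.
Proof.
apply/seteqP; split=> [_ [_ [a Na <-] <-]|_ [a Na <-]].
  exists (a^-1 ^ x^-1); last by free_group.
  by apply: nN.2; exact: (subgroupV sN).
exists (x * (a^-1 ^ x)); last by free_group.
by exists (a^-1 ^ x) => //; apply: nN.2; exact: (subgroupV sN).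
Qed.

Lemma quotient_set_closed_subgroup K : is_subgroup K ->
  is_closed_subgroup_quotient K N (quotient_set K N).
Proof.
move=> sK; split=> //.
- by exists 1; [exact: (subgroup1 sK)|exact: left_coset1].
- move=> _ _ [x Kx <-] [y Ky <-]; rewrite left_cosetM.
  by exists (x * y) => //; exact: (subgroupM sK).
- move=> _ [x Kx <-]; rewrite left_cosetV.
  by exists x^-1 => //; exact: (subgroupV sK).
- exists setT; first exact: closedT.
  by apply/seteqP; split=> x [Kx _]; split=> //; exists x.
Qed.

Lemma quotient_preimage_subgroup K Q : is_subgroup K -> N `<=` K ->
  is_closed_subgroup_quotient K N Q ->
  is_subgroup [set x | K x /\ Q (left_coset N x)].
Proof.
move=> sK NK [QK Q1 QM QV _]; split=> /=.
- by rewrite left_coset1; split=> //; exact: (subgroup1 sK).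
- move=> x y [Kx Qx] [Ky Qy]; rewrite -left_cosetM.
  by split; [exact: (subgroupM sK)|exact: QM].
- by move=> x [Kx Qx]; rewrite -left_cosetV; split; [exact: (subgroupV sK)|exact: QV].
Qed.

End Cosets.

Theorem theorem4p6 (p n : nat) (d : Order.disp_t) (X : orderType d)
    (S : profiniteGroupType) (iota : X -> S)
    (HH : set (free_magma X)) (le : free_magma X -> free_magma X -> Prop) :
  prime p -> (1 <= n)%N -> [set: X] !=set0 ->
  is_free_profinite iota ->
  is_hall_set HH le ->
  let Snp : set S := zassenhaus n p in
  let N := set_mulg (closed_power Snp p) (closed_commg [set: S] Snp) in
  generates_quotient Snp N
    [set left_coset N (sigma p n iota HH w) |
      w in [set w | hall_words HH w /\ J_set p n (size w)]].
Proof.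
move=> p_pr n_gt0 _ [_ iotaS _] hallH Snp N.
have nS : is_normal_subgroup Snp := zassenhaus_normal _ _ _.
have sS := nS.1.
have nP : is_normal_subgroup (closed_power Snp p) := closed_power_normal p nS.
have nC : is_normal_subgroup (closed_commg [set: S] Snp) := closed_commg_normal nS.
have nN : is_normal_subgroup N := set_mulg_normal nP nC.
have cS : closed Snp := @closed_gen_closed _ _.
have NS : N `<=` Snp.
  move=> _ [x xP [y yC <-]]; apply: (subgroupM sS).
    by move: (x) xP; apply: closed_gen_min => // _ [z Sz <-]; exact: (subgroupX sS).
  move: (y) yC; apply: closed_gen_min => // _ [g _ [z Sz <-]].
  rewrite commgEr; apply: (subgroupM sS) => //.
  by apply: nS.2; exact: (subgroupV sS).
have sigmaE h : HH h -> sigma p n iota HH (foliage h) =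
    tau_tree iota h ^+ (p ^ j_index p n (size (foliage h))).
  by move=> Hh; rewrite /sigma (tau_foliage hallH).
have sigmaS w : hall_words HH w -> J_set p n (size w) ->
    Snp (sigma p n iota HH w).
  move=> [h Hh <-] _; rewrite sigmaE //.
  have h0 := size_foliage_gt0 h.
  apply: (mem_zassenhaus h0 _ (tau_tree_lower_central iota h)).
  by rewrite -j_index_leq.
split; first by move=> _ [w [Hw Jw] <-]; exists (sigma p n iota HH w) => //; exact: sigmaS.
apply/seteqP; split.
  apply: smallest_sub; first exact: quotient_set_closed_subgroup.
  by move=> _ [w [Hw Jw] <-]; exists (sigma p n iota HH w) => //; exact: sigmaS.
move=> _ [x Sx <-] Q [QP TQ].
(* Pulls an arbitrary closed subgroup [Q] containing the given cosets back to a closed subgroup of S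
   that contains [N], so that [zassenhaus_sub] applies. *)
pose U := [set y | Snp y /\ Q (left_coset N y)].
suff SU : Snp `<=` U by case: (SU x Sx).
have sU : is_subgroup U := quotient_preimage_subgroup nN sS NS QP.
have cU : closed U.
  by case: QP => _ _ _ _ [C cC UE]; rewrite /U UE; exact: closedI.
have NU : N `<=` U.
  move=> y Ny; split; first exact: NS.
  by rewrite left_coset_mem //; case: QP.
pose T i := [set tau_tree iota h | h in [set h | HH h /\ size (foliage h) = i]].
apply: (@zassenhaus_sub S p n U T p_pr n_gt0 sU cU).
- move=> y Sy; apply: NU; exists (y ^+ p); first exact: mem_closed_power.
  by exists 1; [exact: (subgroup1 nC.1)|rewrite mulg1].
- move=> y z Sz; apply: NU; exists 1; first exact: (subgroup1 nP.1).
  by exists [~ y, z]; [exact: mem_closed_commg|rewrite mul1g].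
- by move=> i i0; exact: (lower_central_hall hallH).
- by move=> i _ [h [_ <-] <-]; exact: tau_tree_lower_central.
- move=> i _ Ji [h [Hh dh] <-].
  have Hw : hall_words HH (foliage h) by exists h.
  rewrite -dh -sigmaE // -[U _]/(_ /\ _); rewrite -dh in Ji.
  by split; [exact: sigmaS|apply: TQ; exists (foliage h)].
Qed.
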